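(* Let $u:\mathbb{R}^n\to\mathbb{R}\cup\{+\infty\}$ be a closed proper convex function with Legendre conjugate $u^*$. Then $$u\in C_M \iff u^*\in C_M^*,$$ and in this case $J(u)=J^*(u^* )$.
   Context: Let $\Omega\subset\mathbb{R}^n$ be a convex compact set with nonempty interior and let $M\ge 0$. $\mathbb{R}^{n*}$ denotes the dual space of the Euclidean space $\mathbb{R}^n$, canonically identified with $\mathbb{R}^n$. A convex function is closed if it is lower semicontinuous (its epigraph is closed); $\operatorname{dom} u=\{x: u(x)<+\infty\}$; $\partial$ denotes the convex subdifferential. $C_M$ is the set of closed convex functions $u:\mathbb{R}^n\to\mathbb{R}\cup\{+\infty\}$ with $\operatorname{dom}u=\Omega$, $\inf u=0$, and $u\le M$ on $\Omega$. For $u\in C_M$, $$J(u)=\int_\Omega\frac{1}{1+|u'(x)|^2}\,dx,$$ where the gradient $u'(x)$ exists for almost every $x\in\Omega$. The Legendre conjugate is $u^*(p)=\sup_{x}(\langle p,x\rangle-u(x))$, $p\in\mathbb{R}^{n*}$. The supporting function of $\Omega$ is $s_\Omega(p)=\sup_{x\in\Omega}\langle p,x\rangle$. $C_M^*$ is the set of closed convex functions $w$ on $\mathbb{R}^{n*}$ such that (i) $w(0)=0$; (ii) $w(p)\ge s_\Omega(p)-M$ for all $p\in\mathbb{R}^{n*}$; (iii) $\partial w(p)\subset\Omega$ for all $p\in\mathbb{R}^{n*}$. Hessian measures: for a convex function $w$ on $\mathbb{R}^{n*}$, a Borel set $\eta\subset\mathbb{R}^{n*}$ and $\varepsilon\ge0$,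 put $\eta^\varepsilon=\bigcup_{p\in\eta}(p+\varepsilon\,\partial w(p))$. Then $L^n(\eta^\varepsilon)=\sum_{j=0}^n\binom{n}{j}F_{n-j}(\eta|w)\varepsilon^j$, where $L^n$ is Lebesgue measure, and the coefficients $F_j(\cdot|w)$ are the Hessian measures of $w$. In particular $F_0(\eta|w)=L^n\big(\bigcup_{p\in\eta}\partial w(p)\big)$. For $w\in C_M^*$, $$J^*(w)=\int_{\mathbb{R}^{n*}}\frac{1}{1+|p|^2}\,F_0(dp|w).$$ *)

(* Defs.v *)
From HB Require Import structures.
From mathcomp Require Import all_boot all_order all_algebra.
From mathcomp Require Import all_classical all_reals all_analysis.
Import Order.TTheory GRing.Theory Num.Theory.
Import numFieldNormedType.Exports.

Set Implicit Arguments.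
Unset Strict Implicit.
Unset Printing Implicit Defensive.

Local Open Scope classical_set_scope.
Local Open Scope ring_scope.

(* R^n is 'rV[R]_n with its product topology (which is the
   Euclidean one), and R^{n*} is identified with R^n through [dot].  The norm
   `|x| that the library puts on 'rV[R]_n is the sup norm, so the squared
   Euclidean norm |x|^2 is always written [dot x x]. *)
Definition dot (R : realType) (n : nat) (p x : 'rV[R]_n) : R :=
  \sum_i p 0 i * x 0 i.

Section Lebesgue.
Context {R : realType} {n : nat}.
Local Notation V := 'rV[R]_n.+1.

Definition box (ab : V * V) : set V :=
  [set x | forall i, x 0 i \in `]ab.1 0 i, ab.2 0 i]].

(* The [max] makes the volume 0 as soon as one of the sides is empty. *)
Definition box_volume (ab : V * V) : R :=
  \prod_i Num.max 0 (ab.2 0 i - ab.1 0 i).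

Definition lebesgue_outer (A : set V) : \bar R :=
  ereal_inf [set (\sum_(k <oo) (box_volume (I k))%:E)%E | I in
    [set I : nat -> V * V | A `<=` \bigcup_k box (I k)]].

Local Open Scope ereal_scope.

Let volume_ge0 ab : 0 <= (box_volume ab)%:E.
Proof.
by rewrite lee_fin; apply: prodr_ge0 => i _; rewrite le_max lexx.
Qed.

Lemma lebesgue_outer_ge0 A : 0 <= lebesgue_outer A.
Proof.
by apply: le_ereal_inf_tmp => _ [I _ <-]; apply: nneseries_ge0 => k *.
Qed.

Lemma lebesgue_outer0 : lebesgue_outer set0 = 0.
Proof.
apply/eqP; rewrite eq_le lebesgue_outer_ge0 andbT.
apply: ereal_inf_lbound; exists (fun=> (0%R, 0%R)); first by move=> x [].
rewrite eseries0// => k _ _; congr EFin.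
by rewrite /box_volume (bigD1 ord0)//= subrr maxxx mul0r.
Qed.

Lemma le_lebesgue_outer :
  {homo lebesgue_outer : A B / A `<=` B >-> A <= B}.
Proof.
move=> A B AB; apply/ereal_inf_le_tmp => x [I BI <-{x}].
by exists I => //; exact: subset_trans AB BI.
Qed.

Lemma lebesgue_outer_sigma_subadditive : sigma_subadditive lebesgue_outer.
Proof.
move=> A; have [[i ioo]|] := pselect (exists i, lebesgue_outer (A i) = +oo).
  rewrite (eseries_pinfty _ _ ioo) ?leey// => k _.
  by rewrite -ltNye (lt_le_trans _ (lebesgue_outer_ge0 _)).
rewrite -forallNE => Aoo.
suff add2e (e : {posnum R}) : lebesgue_outer (\bigcup_k A k) <=
    \sum_(i <oo) lebesgue_outer (A i) + e%:num%:E.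
  by apply/lee_addgt0Pr => _/posnumP[].
rewrite (le_trans _ (epsilon_trick _ _ _))//; last first.
  by move=> k; exact: lebesgue_outer_ge0.
pose P k (I : nat -> V * V) := A k `<=` \bigcup_j box (I j) /\
  \sum_(j <oo) (box_volume (I j))%:E <=
    lebesgue_outer (A k) + (e%:num / (2 ^ k.+1)%:R)%:E.
have [G PG] : {G : nat -> nat -> V * V & forall k, P k (G k)}.
  apply: (@choice _ _ P) => k; rewrite /P /lebesgue_outer.
  set S := (X in ereal_inf X); move infS : (ereal_inf S) => iS.
  case: iS infS => [r Sr|Soo|Soo].
  - have en1 : (0 < e%:num / (2 ^ k.+1)%:R)%R by [].
    have /(lb_ereal_inf_adherent en1) : ereal_inf S \is a fin_num by rewrite Sr.
    move=> [x [B AB xB xS]].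
    by exists B; split => //; rewrite xB -Sr; exact/ltW.
  - by have := Aoo k; rewrite /lebesgue_outer Soo.
  - suff : lbound S 0 by move/le_ereal_inf_tmp; rewrite Soo.
    by move=> /= _ [B AB <-]; apply: nneseries_ge0 => *.
pose vol (ij : nat * nat) := (box_volume (G ij.1 ij.2))%:E.
apply: (@le_trans _ _ (\esum_(ij in setT) vol ij)).
  apply: ereal_inf_lbound => /=.
  have /card_esym/ppcard_eqP[f] := card_nat2.
  exists (fun k => G (f k).1 (f k).2).
    move=> t [i _ /(PG i).1[j _ Gijt]].
    by exists (f^-1%FUN (i, j)) => //=; rewrite invK ?inE.
  rewrite -(esum_pred_image vol f xpredT) ?[fun=> _]set_true//.
  - by rewrite image_eq.
  - by move=> k _; exact: volume_ge0.
rewrite (_ : esum _ _ = \sum_(i <oo) \sum_(j <oo) vol (i, j)); last first.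
  pose J : nat -> set (nat * nat) := fun i => [set (i, j) | j in setT].
  rewrite (_ : setT = \bigcup_k J k); last first.
    by rewrite predeqE => -[a b]; split => // _; exists a => //; exists b.
  rewrite esum_bigcupT /=; last 2 first.
    - apply/trivIsetP => i j _ _ ij.
      rewrite predeqE => -[k m] /=; split => //= -[] [_] _ [<-{k} _].
      by move=> [m' _] [] /esym/eqP; rewrite (negbTE ij).
    - by move=> k; exact: volume_ge0.
  rewrite -(image_id [set: nat]) -fun_true esum_pred_image//; last first.
    by move=> k _; apply: esum_ge0 => *; exact: volume_ge0.
  apply: eq_eseriesr => /= j _.
  rewrite -(esum_pred_image vol (pair j) predT)//=; last 2 first.
  - by move=> k _; exact: volume_ge0.
  - by move=> ? ? _ _; exact: (@can_inj _ _ _ snd).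
  by congr esum; rewrite predeqE => -[a b]; split; move=> [i _ <-]; exists i.
apply: lee_lim.
- apply: is_cvg_nneseries => k *.
  by apply: nneseries_ge0 => m *; exact: volume_ge0.
- apply: is_cvg_nneseries => k *; apply: adde_ge0 => //.
  exact: lebesgue_outer_ge0.
- by near=> k; apply: lee_sum => i _; exact: (PG i).2.
Unshelve. all: by end_near. Qed.

HB.instance Definition _ := isOuterMeasure.Build R V lebesgue_outer
  lebesgue_outer0 lebesgue_outer_ge0 le_lebesgue_outer
  lebesgue_outer_sigma_subadditive.

End Lebesgue.

(* [lebesgueType] carries the complete sigma-algebra of Lebesgue measurable
   sets, and [lebesgue_n] is the Lebesgue measure L^n on it; as a function on
   sets, [lebesgue_n] is total and coincides with [lebesgue_outer]. *)
Definition lebesgue_outer_measure (R : realType) (n : nat) :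
  {outer_measure set 'rV[R]_n.+1 -> \bar R} := lebesgue_outer.

Definition lebesgueType (R : realType) (n : nat) :=
  caratheodory_type (lebesgue_outer_measure R n).

Definition lebesgue_n (R : realType) (n : nat) :
    {measure set (lebesgueType R n) -> \bar R} :=
  (lebesgue_outer_measure R n : set (lebesgueType R n) -> \bar R).

Definition borelType (R : realType) (n : nat) :=
  g_sigma_algebraType (@open 'rV[R]_n.+1).

Section ConvexAnalysis.
Context {R : realType} {n : nat}.
Local Notation V := 'rV[R]_n.
Local Open Scope ereal_scope.

Definition effdom (u : V -> \bar R) : set V := [set x | u x < +oo].

Definition epigraph (u : V -> \bar R) : set (V * R^o)%type :=
  [set z | u z.1 <= (z.2 : R)%:E].

(* Values in R \cup {+oo}; the function +oo is not excluded. *)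
Definition closed_convex (u : V -> \bar R) : Prop :=
  [/\ forall x, -oo < u x, convex_set (epigraph u) & lower_semicontinuous u].

Definition proper_fun (u : V -> \bar R) : Prop :=
  (forall x, -oo < u x) /\ effdom u !=set0.

Definition legendre_conj (u : V -> \bar R) (p : V) : \bar R :=
  ereal_sup [set (dot p x)%:E - u x | x in setT].

Definition support_fun (Omega : set V) (p : V) : \bar R :=
  ereal_sup [set (dot p x)%:E | x in Omega].

(* Empty where [w] is infinite. *)
Definition subdiff (w : V -> \bar R) (p : V) : set V :=
  [set x | w p \is a fin_num /\ forall q, w p + (dot (q - p) x)%:E <= w q].

(* An arbitrary vector where [f] is not differentiable. *)
Definition gradient (f : V -> R) (x : V) : V :=
  (\row_i ('d f x (delta_mx 0 i) : R))%R.

Definition CM (Omega : set V) (M : R) (u : V -> \bar R) : Prop :=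
  [/\ closed_convex u, effdom u = Omega, ereal_inf (range u) = 0
    & forall x, Omega x -> u x <= M%:E].

Definition CMstar (Omega : set V) (M : R) (w : V -> \bar R) : Prop :=
  [/\ closed_convex w, w 0%R = 0,
      forall p, support_fun Omega p - M%:E <= w p
    & forall p, subdiff w p `<=` Omega].

End ConvexAnalysis.

Section Functionals.
Context {R : realType} {n : nat}.
Local Notation V := 'rV[R]_n.+1.
Local Open Scope ereal_scope.

(* At an interior point of [effdom u], the gradient of [fine \o u] is that of
   u.  For u in [CM Omega M] it exists almost everywhere on Omega, and the
   integral does not see the remaining points. *)
Definition J (Omega : set V) (u : V -> \bar R) : \bar R :=
  let u' := gradient (fine \o u) in
  \int[lebesgue_n R n]_(x in (Omega : set (lebesgueType R n)))
    ((1 + dot (u' x) (u' x))^-1)%:E.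

(* The Hessian measure F_0(. | w), i.e. the coefficient of eps^n in the
   expansion of L^n(\bigcup_(p in eta) (p + eps *: subdiff w p)). *)
Definition hessian0 (w : V -> \bar R) (eta : set (borelType R n)) : \bar R :=
  lebesgue_n R n (\bigcup_(p in eta) subdiff w p).

(* The library's integral takes any set function; here it only involves the
   values of [hessian0 w] on Borel sets, where it is a measure when w is
   convex. *)
Definition Jstar (w : V -> \bar R) : \bar R :=
  \int[hessian0 w]_p ((1 + dot p p)^-1)%:E.

End Functionals.

(* Main.v *)
From HB Require Import structures.
Require Import Defs.
From mathcomp Require Import all_boot all_order all_algebra.
From mathcomp Require Import all_classical all_reals all_analysis.
From mathcomp Require Import measurable_realfun.
From mathcomp Require Import ring lra.
Import Order.TTheory GRing.Theory Num.Theory.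
Import numFieldNormedType.Exports.

(** Both halves of the theorem rest on one variational fact ([prox_subdiff]).
    Let [f >= 0] be closed convex and proper, [c > 0] and [x] any point.  Then
    [f + c * |x - .| ^ 2] has a minimizer [y], and its first order condition
    says that [2 * c * (x - y)] is a subgradient of [f] at [y].  As [c] grows,
    [y] tends to [x] when [x] is in the domain.

    The equivalence.  Since [w = u^*] satisfies [w 0 = - inf u], one may assume
    [u >= 0] on both sides.  Letting [c] grow in the fact above gives the
    Fenchel-Moreau identity [u^** = u] ([biconj]), hence [x] is a subgradient of
    [w] at [p] exactly when [p] is a subgradient of [u] at [x] ([subdiff_conj]).
    The bound [w >= s_Omega - M] is thus dual to [u <= M] on [Omega].  The
    condition that all subgradients of [w] are in [Omega] says that [u] has
    subgradients at points of [Omega] only.  Such points are dense in the domain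
    of [u] ([subdiff_dense]), so, [Omega] being closed, it amounts to the
    inclusion of the domain of [u] in [Omega].

    The integrals.  Let [D] be the set of interior points of [Omega] where [u]
    has exactly one subgradient.  On [D] that subgradient is the gradient of [u]
    ([gradient_unique_subdiff]), because the subdifferential is upper
    semicontinuous inside [Omega] ([subdiff_usc]); this also makes it nonempty
    there ([subdiff_interior_nonempty]).  The complement of [D] in
    [Omega] is null for two reasons.  First, the points where a function has two
    subgradients lie on countably many Lipschitz graphs, by monotonicity of the
    subdifferential ([subdiff_multi_null]).  Second, the boundary of [Omega]
    consists of such points for the indicator function of [Omega]
    ([convex_boundary_null]).  So, up to a null set, the union of the
    subdifferentials of [w] over [eta] is the part of [D] that the gradient maps
    into [eta]: the Hessian measure [F_0] of [w] is the image under the gradient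
    of the Lebesgue measure on [D], and [J u = J^* w] is the change of variables
    formula for image measures ([J_Jstar]). *)

Set Implicit Arguments.
Unset Strict Implicit.
Unset Printing Implicit Defensive.

Local Open Scope classical_set_scope.
Local Open Scope ring_scope.

(** * The scalar product *)

Lemma fst_continuous (S T : topologicalType) : continuous (@fst S T).
Proof. by move=> [a b]; exact: cvg_fst. Qed.

Lemma snd_continuous (S T : topologicalType) : continuous (@snd S T).
Proof. by move=> [a b]; exact: cvg_snd. Qed.

Section Dot.
Context {R : realType} {n : nat}.
Local Notation V := 'rV[R]_n.
Implicit Types p q x y : V.

Lemma dotC p x : dot p x = dot x p.
Proof. by apply: eq_bigr => i _; rewrite mulrC. Qed.

Lemma dotDl p q x : dot (p + q) x = dot p x + dot q x.
Proof. by rewrite -big_split; apply: eq_bigr => i _; rewrite mxE mulrDl. Qed.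

Lemma dotZl a p x : dot (a *: p) x = a * dot p x.
Proof. by rewrite mulr_sumr; apply: eq_bigr => i _; rewrite mxE mulrA. Qed.

Lemma dotBl p q x : dot (p - q) x = dot p x - dot q x.
Proof. by rewrite dotDl -scaleN1r dotZl mulN1r. Qed.

Lemma dotDr p x y : dot p (x + y) = dot p x + dot p y.
Proof. by rewrite dotC dotDl !(dotC p). Qed.

Lemma dotZr a p x : dot p (a *: x) = a * dot p x.
Proof. by rewrite dotC dotZl dotC. Qed.

Lemma dotBr p x y : dot p (x - y) = dot p x - dot p y.
Proof. by rewrite dotC dotBl !(dotC p). Qed.

Lemma dot_sqrB t x y :
  dot (x - t *: y) (x - t *: y) =
  dot x x - 2 * t * dot x y + t ^+ 2 * dot y y.
Proof. by rewrite dotBl !dotBr !dotZl !dotZr (dotC y x); ring. Qed.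

Lemma dot0l x : dot 0 x = 0.
Proof. by rewrite /dot big1// => i _; rewrite mxE mul0r. Qed.

Lemma dot_delta p i : dot p (delta_mx 0 i) = p 0 i.
Proof.
rewrite /dot (bigD1 i)//= mxE !eqxx mulr1 big1 ?addr0// => j ji.
by rewrite mxE eqxx (negbTE ji) mulr0.
Qed.

Lemma coord_le_norm x i : `|x 0 i| <= `|x|.
Proof.
rewrite [leRHS]/Num.Def.normr /= mx_normrE.
by apply/bigmax_geP; right; exists (0, i).
Qed.

Lemma norm_le_coord x (r : R) : 0 <= r ->
  (forall i, `|x 0 i| <= r) -> `|x| <= r.
Proof.
move=> r0 xr; rewrite [leLHS]/Num.Def.normr /= mx_normrE.
by apply/bigmax_leP; split=> // -[i j] _ /=; rewrite ord1.
Qed.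

Lemma dot_ge0 x : 0 <= dot x x.
Proof. by apply: sumr_ge0 => i _; rewrite -expr2 sqr_ge0. Qed.

Lemma norm_sqr_le_dot x : `|x| ^+ 2 <= dot x x.
Proof.
change (mx_norm x ^+ 2 <= dot x x).
have [->|/mx_norm_neq0[[i j] /= ->]] := eqVneq (mx_norm x) 0.
  by rewrite expr0n dot_ge0.
rewrite ord1 real_normK ?num_real//.
rewrite /dot (bigD1 j)//= -expr2 lerDl.
by apply: sumr_ge0 => k _; rewrite -expr2 sqr_ge0.
Qed.

Lemma dot_le_norm p x : `|dot p x| <= n%:R * (`|p| * `|x|).
Proof.
rewrite (le_trans (ler_norm_sum _ _ _))//.
have -> : n%:R * (`|p| * `|x|) = \sum_(i < n) (`|p| * `|x|).
  by rewrite sumr_const card_ord mulr_natl.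
by apply: ler_sum => i _; rewrite normrM ler_pM// coord_le_norm.
Qed.

Lemma dot_continuous : continuous (fun z : V * V => dot z.1 z.2).
Proof.
apply: continuous_big => [|i _ z]; first exact: add_continuous.
apply: cvgM.
- by apply: (cvg_comp fst (fun x : V => x 0 i)); [exact: fst_continuous|
    exact: coord_continuous].
- by apply: (cvg_comp snd (fun x : V => x 0 i)); [exact: snd_continuous|
    exact: coord_continuous].
Qed.

Lemma continuous_dot (T : topologicalType) (f g : T -> V) (x : T) :
  {for x, continuous f} -> {for x, continuous g} ->
  {for x, continuous (fun y : T => dot (f y) (g y))}.
Proof.
by move=> cf cg; apply: continuous2_cvg cf cg; exact: (@dot_continuous (_, _)).
Qed.

Lemma continuous_subl (x : V) : continuous (fun t : V => x - t).
Proof.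
move=> z; apply: (@continuousB _ _ _ (cst x) id).
- exact: cst_continuous.
- exact: cvg_id.
Qed.

Lemma continuous_sqr_dist (x : V) :
  continuous (fun z : V => dot (x - z) (x - z)).
Proof.
move=> z; have cx := @continuous_subl x z.
exact: (@continuous_dot V _ _ z cx cx).
Qed.

End Dot.
(** * Minimizers of quadratically penalized convex functions *)

Section Lsc.
Context {R : realType}.
Local Open Scope ereal_scope.

Lemma lsc_comp (S T : topologicalType) (f : T -> \bar R) (h : S -> T) :
  lower_semicontinuous f -> continuous h -> lower_semicontinuous (f \o h).
Proof.
move=> lf ch x a /lf[W Wx Wa].
by exists (h @^-1` W); [exact: ch|move=> y /Wa].
Qed.

Lemma lscD (T : topologicalType) (f : T -> \bar R) (g : T -> R) :
  (forall x, -oo < f x) -> lower_semicontinuous f -> continuous g ->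
  lower_semicontinuous (fun x => f x + (g x)%:E).
Proof.
move=> fNy lf cg x a afg.
have [s [sf asg]] : exists s : R, s%:E < f x /\ (a - s < g x)%R.
  move: (fNy x) afg; case: (f x) => [r _| _ _|//].
    rewrite -EFinD lte_fin => arg.
    by exists ((r + a - g x) / 2)%R; rewrite lte_fin; split; lra.
  by exists (a - g x + 1)%R; rewrite ltry; split => //; lra.
have [W Wx Ws] := lf _ _ sf.
exists (W `&` g @^-1` [set r | (a - s < r)%R]).
  apply: filterI => //; apply: cg; apply: open_nbhs_nbhs.
  by split => //; exact: open_gt.
move=> y [/Ws sy /= asy]; rewrite (@lt_trans _ _ (s + g y)%:E)//.
  by rewrite lte_fin; lra.
by rewrite EFinD lteD2rE.
Qed.

End Lsc.

Section Prox.
Context {R : realType} {n : nat}.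
Local Notation V := 'rV[R]_n.
Variable f : V -> \bar R.
Hypotheses (fcc : closed_convex f) (f_ge0 : forall x, (0 <= f x)%E).
Hypothesis fdom : effdom f !=set0.

Lemma closed_convex_segment x y a b t :
  (f x <= a%:E)%E -> (f y <= b%:E)%E -> 0 <= t -> t <= 1 ->
  (f (x + t *: (y - x)) <= (a + t * (b - a))%:E)%E.
Proof.
move=> fxa fyb t0 t1; have [_ cf _] := fcc.
have := cf (y, b) (x, a) (Itv01 t0 t1).
rewrite !inE => /(_ fyb fxa); rewrite /epigraph /conv /= /unstable.onem.
suff -> : t *: y + (1 - t) *: x = x + t *: (y - x).
  suff -> : t *: (b : R^o) + (1 - t) *: (a : R^o) = a + t * (b - a) by [].
  by rewrite /GRing.scale /=; ring.
by rewrite scalerBl scale1r scalerBr addrCA.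
Qed.

Let energy c x z := (f z + (c * dot (x - z) (x - z))%:E)%E.

Let energy_lsc c x : lower_semicontinuous (energy c x).
Proof.
have [fNy _ lf] := fcc; apply: lscD => // z.
exact: (continuousM (@cst_continuous _ _ c z) (@continuous_sqr_dist _ _ x z)).
Qed.

Let energy_ge c x z : 0 < c -> ((c * `|x - z| ^+ 2)%:E <= energy c x z)%E.
Proof.
move=> c0; rewrite /energy -[leLHS]add0e leeD// lee_fin ler_wpM2l//.
  exact: ltW.
exact: norm_sqr_le_dot.
Qed.

(** As [f >= 0], a minimizing sequence stays bounded; lower semicontinuity makes
    any of its cluster points a minimizer. *)
Lemma prox_exists c x : 0 < c ->
  exists y, forall z, (f y + (c * dot (x - y) (x - y))%:E <=
                       f z + (c * dot (x - z) (x - z))%:E)%E.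
Proof.
move=> c0; set phi := energy c x.
have phi0 z : (0 <= phi z)%E.
  by apply: le_trans (energy_ge x z c0); rewrite lee_fin mulr_ge0// ltW.
set m := ereal_inf (range phi).
have m0 : (0 <= m)%E by apply: le_ereal_inf_tmp => _ [z _ <-].
have mfin : m \is a fin_num.
  rewrite ge0_fin_numE//; have [z0 fz0] := fdom.
  apply: (@le_lt_trans _ _ (phi z0)).
    by apply: ereal_inf_lbound; exists z0.
  by apply: lte_add_pinfty; [exact: fz0|exact: ltry].
have /choice[z_ z_m] (k : nat) : exists z, (phi z < m + k.+1%:R^-1%:E)%E.
  have k0 : 0 < k.+1%:R^-1 :> R by [].
  by have [_ [z _ <-] ?] := lb_ereal_inf_adherent k0 mfin; exists z.
(* If [t > 1] and [c * t ^+ 2 <= m + 1], then [t <= t ^+ 2 <= (m + 1) / c]. *)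
pose r := Num.max 1 ((fine m + 1) / c).
have zK k : `|x - z_ k| <= r.
  rewrite /r le_max; have [//|x1 /=] := leP `|x - z_ k| 1.
  rewrite ler_pdivlMr// mulrC.
  apply: (@le_trans _ _ (c * `|x - z_ k| ^+ 2)).
    by rewrite ler_pM2l// expr2 ler_peMr// ltW.
  rewrite -lee_fin (le_trans (energy_ge _ _ c0))// (le_trans (ltW (z_m k)))//.
  by rewrite EFinD fineK// leeD2l// lee_fin invf_le1// ler1n.
have cK : compact [set z : V | `|x - z| <= r].
  apply: bounded_closed_compact.
    exists (`|x| + r); split; first exact: num_real.
    move=> M xM z /= xz; apply: le_trans (ltW xM).
    by rewrite -(subKr x z) (le_trans (ler_normB _ _))// lerD2l.
  apply: (@closed_comp _ _ (fun z : V => `|x - z|) [set t | t <= r]).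
    move=> z _; apply: continuous_comp; last exact: norm_continuous.
    exact: continuous_subl.
  exact: closed_le.
have [|y [_ yz]] := cK (z_ @ \oo) _.
  by exists 0%N => // k _; exact: zK.
exists y => z; rewrite -/(energy _ _ _) -/(phi y) -/(energy _ _ _) -/(phi z).
apply: (@le_trans _ _ m); last by apply: ereal_inf_lbound; exists z.
rewrite leNgt; apply/negP => my.
have [a [ma ay]] : exists a : R, (m < a%:E)%E /\ (a%:E < phi y)%E.
  move: my; rewrite -(fineK mfin); case: (phi y) => [s| |//].
    rewrite lte_fin => ms; exists ((fine m + s) / 2).
    by rewrite !lte_fin; split; lra.
  by exists (fine m + 1); rewrite ltry lte_fin; split => //; lra.
have [W Wy Wa] := energy_lsc ay.
have [k0 _ k0a] : \forall k \near \oo, k.+1%:R^-1 < a - fine m.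
  by apply: near_infty_natSinv_lt (PosNum _); rewrite subr_gt0 -lte_fin fineK.
have [_ [[k kk0 <-] Wz]] : (z_ @` [set k | (k0 <= k)%N]) `&` W !=set0.
  apply: yz => //; exists k0 => // k kk0; by exists k.
have := Wa _ Wz; rewrite -/(phi _) ltNge => /negP; apply.
rewrite (le_trans (ltW (z_m k)))// -(fineK mfin) -EFinD lee_fin.
by rewrite -lerBrDl; exact/ltW/k0a.
Qed.

(** This is the first order condition at the minimizer [y]: it is obtained by
    comparing the energies of [y] and of [y + t *: (z - y)], dividing by [t] and
    letting [t] tend to [0]. *)
Lemma prox_subdiff c x : 0 < c ->
  exists y, subdiff f y (2 * c *: (x - y)) /\
    forall z, (f y + (c * dot (x - y) (x - y))%:E <=
               f z + (c * dot (x - z) (x - z))%:E)%E.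
Proof.
move=> c0; have [y ymin] := prox_exists x c0; exists y; split=> //.
have fyfin : f y \is a fin_num.
  rewrite ge0_fin_numE//; have [z0 fz0] := fdom.
  have := ymin z0; move: (f_ge0 y) (f_ge0 z0) fz0; rewrite /effdom /=.
  by case: (f y) => // [r|]; [rewrite ltry|case: (f z0)].
split=> // z; have := f_ge0 z; case fzE: (f z) => [b| |] // _; last first.
  by rewrite leey.
move: fyfin ymin; case fyE: (f y) => [a| |] // _ ymin.
rewrite -EFinD lee_fin dotZr dotC.
set v := x - y; set w := z - y; set S := dot w w; set B := dot v w.
have S0 : 0 <= S by exact: dot_ge0.
have key t : 0 <= t -> t <= 1 -> t * (2 * c * B) <= t * (b - a + c * t * S).
  move=> t0 t1.
  have := ymin (y + t *: (z - y)).
  have := @closed_convex_segment y z a b t.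
  rewrite fyE fzE => /(_ (lexx _) (lexx _) t0 t1) ft.
  move/le_trans/(_ (leeD2r _ ft)); rewrite -!EFinD lee_fin.
  by rewrite opprD addrA dot_sqrB -/S -/B; lra.
(* Rather than passing to the limit, [t] is chosen so that the error term
   [c * t * S] is smaller than the gap [D] that is to be excluded. *)
rewrite leNgt; apply/negP; set d := 2 * c * B; rewrite -subr_gt0.
set D := (X in 0 < X) => D0.
have cS : 0 <= c * S by rewrite mulr_ge0// ltW.
have DcS : 0 < D + c * S by rewrite ltr_pwDl.
have t0 : 0 < D / (D + c * S) by rewrite divr_gt0.
have t1 : D / (D + c * S) <= 1 by rewrite ler_pdivrMr// mul1r lerDl.
have := key _ (ltW t0) t1; rewrite ler_pM2l// leNgt => /negP; apply.
have : c * (D / (D + c * S)) * S < D.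
  by rewrite mulrAC mulrA ltr_pdivrMr// mulrC ltr_pM2l// ltrDr.
rewrite /D /d; lra.
Qed.

End Prox.
(** * Legendre conjugation *)

Section Conjugate.
Context {R : realType} {n : nat}.
Local Notation V := 'rV[R]_n.
Implicit Type f : V -> \bar R.
Local Open Scope ereal_scope.

Lemma conj_ge f p x : (dot p x)%:E - f x <= legendre_conj f p.
Proof. by apply: ereal_sup_ubound; exists x. Qed.

(** Subgradients are the cases of equality in Young's inequality [conj_ge]. *)
Lemma subdiff_conjP f p x :
  subdiff f x p <->
  f x \is a fin_num /\ legendre_conj f p = (dot p x)%:E - f x.
Proof.
split=> [[fx sub]|[fx fp]]; split=> //.
  apply/eqP; rewrite eq_le conj_ge andbT.
  apply: ge_ereal_sup => _ [z _ <-].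
  have := sub z; rewrite dotBl -(fineK fx) !(dotC _ p).
  case: (f z) => [b| |]//=; last by rewrite leNye.
  by rewrite -EFinD -!EFinB !lee_fin; lra.
move=> z; have := conj_ge f p z; rewrite fp dotBl -(fineK fx) !(dotC _ p).
case: (f z) => [b| |]//=; last by rewrite leey.
by rewrite -EFinD -!EFinB !lee_fin; lra.
Qed.

Lemma conj0 f : legendre_conj f 0%R = - ereal_inf (range f).
Proof.
rewrite oppeK; congr ereal_sup; rewrite image_comp.
by apply: eq_imagel => x _ /=; rewrite dot0l add0e.
Qed.

Lemma conj_closed_convex f : (forall x, -oo < f x) -> effdom f !=set0 ->
  closed_convex (legendre_conj f).
Proof.
move=> fNy [z0 fz0]; split.
- move=> p; apply: lt_le_trans (conj_ge f p z0).
  move: (fNy z0) fz0; rewrite /effdom /=.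
  by case: (f z0) => // r _ _; rewrite ltNyr.
- move=> [p a] [q b] t; rewrite !inE /epigraph /= => pa qb.
  apply: ge_ereal_sup => _ [x _ <-].
  have := le_trans (conj_ge f p x) pa; have := le_trans (conj_ge f q x) qb.
  move: (fNy x); case: (f x) => [c _| _ _ _|]//; last by rewrite leNye.
  rewrite -!EFinB !lee_fin => qc pc.
  rewrite /conv /= /unstable.onem dotDl !dotZl.
  have t0 : (0 <= t%:num)%R by [].
  have t1 : (t%:num <= 1)%R by [].
  rewrite /GRing.scale /=; nra.
- move=> p a /ereal_sup_gtP[_ [x _ <-]] afx.
  move: (fNy x) afx; case fxE: (f x) => [b| |]// _ abx.
  rewrite -EFinB lte_fin in abx.
  exists [set q | (a + b < dot q x)%R].
    have /= cx := @continuous_dot R n V (fun q => q) (cst x) p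
      (@cvg_id _ _) (@cst_continuous _ _ x p).
    apply: (cx [set r | (a + b < r)%R]); apply: open_nbhs_nbhs; split.
      exact: open_gt.
    by rewrite /=; lra.
  move=> q /= abq; apply: lt_le_trans (conj_ge f q x).
  by rewrite fxE -EFinB lte_fin; lra.
Qed.

End Conjugate.

Section FenchelMoreau.
Context {R : realType} {n : nat}.
Local Notation V := 'rV[R]_n.
Variable f : V -> \bar R.
Hypotheses (fcc : closed_convex f) (f_ge0 : forall x, (0 <= f x)%E).
Hypothesis fdom : effdom f !=set0.
Local Open Scope ereal_scope.

(** Fenchel-Moreau.  If [y] minimizes [f + c * |x - .| ^ 2], the subgradient
    [p = 2 * c * (x - y)] provides the affine minorant of [f] whose value at [x]
    is [f y + 2 * c * |x - y| ^ 2].  For [c] large this exceeds any [r < f x]: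
    by lower semicontinuity when [y] is close to [x], and through the quadratic
    term otherwise. *)
Lemma biconj x : legendre_conj (legendre_conj f) x = f x.
Proof.
have [fNy _ flsc] := fcc.
apply/eqP; rewrite eq_le; apply/andP; split.
  apply: ge_ereal_sup => _ [p _ <-]; rewrite dotC.
  have := conj_ge f p x; have := fNy x.
  case: (f x) => [a _| |]//; last by rewrite leey.
  case: (legendre_conj f p) => [b| |]//=; last by rewrite leNye.
  by rewrite -!EFinB !lee_fin; lra.
rewrite leNgt; apply/negP => ltf.
have c0 : 0 <= legendre_conj (legendre_conj f) x.
  apply: le_trans (conj_ge _ x 0%R).
  rewrite dotC dot0l add0e conj0 oppeK; apply: le_ereal_inf_tmp => _ [z _ <-].
  exact: f_ge0.
move: c0 ltf (conj_ge (legendre_conj f) x).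
case: (legendre_conj _ x) => [r| _ |]//; last by rewrite ltNge leey.
rewrite lee_fin => r0 rf rge.
have [W /nbhs_ballP[d /= d0 dW] Wr] := flsc _ _ rf.
pose c := ((r + 1) / d ^+ 2)%R.
have c0 : (0 < c)%R by rewrite divr_gt0 ?exprn_gt0//; lra.
have [y [yp _]] := prox_subdiff fcc f_ge0 fdom x c0.
set p := (2 * c *: (x - y))%R in yp.
have := rge p; have [fy ->] := (subdiff_conjP f p y).1 yp.
rewrite -(fineK fy) -!EFinB lee_fin (dotC x) => pr.
have pxy : (2 * c * dot (x - y) (x - y) = dot p x - dot p y)%R.
  by rewrite -dotBr dotZl.
have fy0 : (0 <= fine (f y))%R by exact: fine_ge0.
have [xy|xy] := ltP `|x - y|%R d.
  have : W y by apply: dW; rewrite -ball_normE.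
  move/Wr; rewrite -(fineK fy) lte_fin.
  have : (0 <= 2 * c * dot (x - y) (x - y))%R.
    by rewrite mulr_ge0 ?dot_ge0// mulr_ge0// ltW.
  lra.
have : (d ^+ 2 <= dot (x - y) (x - y))%R.
  by apply: le_trans (norm_sqr_le_dot _); rewrite ler_sqr ?nnegrE ?(ltW d0).
rewrite -(ler_pM2l c0) {1}/c divfK ?gt_eqF ?exprn_gt0//; lra.
Qed.

(** With [biconj], equality in Young's inequality becomes symmetric in [f] and
    its conjugate. *)
Lemma subdiff_conj p x : subdiff (legendre_conj f) p x <-> subdiff f x p.
Proof.
rewrite !subdiff_conjP biconj dotC.
split=> -[]; case: (f x) => [a| |]//; case: (legendre_conj f p) => [b| |]// _;
  rewrite -EFinB => -[->]; split=> //; rewrite -EFinB; congr EFin; ring.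
Qed.

(** At the minimizer [y], [c * |x - y| ^ 2 <= f x]; hence [y] tends to [x] as
    [c] grows. *)
Lemma subdiff_dense x (d : R) : effdom f x -> (0 < d)%R ->
  exists y p, (`|x - y| < d)%R /\ subdiff f y p.
Proof.
rewrite /effdom /= => fx d0; have := f_ge0 x.
move: fx; case fxE: (f x) => [a| |]// _; rewrite lee_fin => a0.
have d20 : (0 < d ^+ 2)%R by rewrite exprn_gt0.
pose c := ((a + 1) / d ^+ 2)%R.
have c0 : (0 < c)%R by rewrite divr_gt0//; lra.
have [y [yp /(_ x)]] := prox_subdiff fcc f_ge0 fdom x c0.
rewrite fxE subrr dot0l mulr0 adde0.
have := f_ge0 y; case: (f y) => [b| |]//.
rewrite -EFinD !lee_fin => b0 ba.
exists y, (2 * c *: (x - y))%R; split=> //.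
rewrite ltNge; apply/negP => dxy.
have : (d ^+ 2 <= dot (x - y) (x - y))%R.
  by apply: le_trans (norm_sqr_le_dot _); rewrite ler_sqr ?nnegrE ?(ltW d0).
by rewrite -(ler_pM2l c0) {1}/c divfK ?gt_eqF//; lra.
Qed.

End FenchelMoreau.

Section Duality.
Context {R : realType} {n : nat}.
Local Notation V := 'rV[R]_n.
Variables (Omega : set V) (M : R) (u : V -> \bar R).
Hypotheses (ucc : closed_convex u) (uproper : proper_fun u).
Local Open Scope ereal_scope.

Lemma ereal_inf_ge0 : ereal_inf (range u) = 0 -> forall x, 0 <= u x.
Proof. by move=> u0 x; rewrite -u0; apply: ereal_inf_lbound; exists x. Qed.

Lemma CM_CMstar : CM Omega M u -> CMstar Omega M (legendre_conj u).
Proof.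
move=> [_ udom u0 uM]; have [uNy dom0] := uproper; split.
- exact: conj_closed_convex.
- by rewrite conj0 u0 oppe0.
- move=> p; rewrite leeBlDr//; apply: ge_ereal_sup => _ [x Ox <-].
  have := conj_ge u p x; have := uM _ Ox; have := uNy x.
  case: (u x) => [a _| |]//; rewrite lee_fin => aM.
  case: (legendre_conj u p) => [b| |]//; last by rewrite addye ?leey.
  by rewrite -EFinB -EFinD !lee_fin; lra.
- move=> p x /(subdiff_conj ucc (ereal_inf_ge0 u0) dom0)[ux _].
  by rewrite -udom /effdom /= -(fineK ux) ltry.
Qed.

(** A point of [effdom u] is a limit of points where [u] has a subgradient
    ([subdiff_dense]); by duality these belong to the closed set [Omega]. *)
Lemma CMstar_CM : closed Omega -> CMstar Omega M (legendre_conj u) ->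
  CM Omega M u.
Proof.
move=> cO [_ w0 wM wO]; have [uNy dom0] := uproper.
have u0 : ereal_inf (range u) = 0.
  by move/eqP: w0; rewrite conj0 oppe_eq0 => /eqP.
have u_ge0 := ereal_inf_ge0 u0.
have uM x : Omega x -> u x <= M%:E.
  move=> Ox; rewrite -(biconj ucc u_ge0 dom0).
  apply: ge_ereal_sup => _ [p _ <-]; rewrite dotC.
  have px : (dot p x)%:E <= support_fun Omega p.
    by apply: ereal_sup_ubound; exists x.
  have := le_trans (leeB px (lexx M%:E)) (wM p).
  case: (legendre_conj u p) => [b| |]//=; last by rewrite leNye.
  by rewrite -!EFinB !lee_fin; lra.
split=> //; apply/seteqP; split=> x.
- move=> ux; apply: cO => W /nbhs_ballP[d /= d0 dW].
  have [y [p [xy yp]]] := subdiff_dense ucc u_ge0 dom0 ux d0.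
  exists y; split; last by apply: dW; rewrite -ball_normE.
  exact/(wO p)/(subdiff_conj ucc u_ge0 dom0).
- by move=> /uM ux; exact: le_lt_trans (ltry M).
Qed.

End Duality.
(** * The subdifferential inside the domain *)

(** The linear form [dot p] is to be recognized as a differential. *)
HB.instance Definition _ {R : realType} {n : nat} (p : 'rV[R]_n) :=
  GRing.isLinear.Build R 'rV[R]_n R _ (dot p)
    (fun a x y => eq_trans (dotDr p (a *: x) y)
       (congr1 (+%R^~ (dot p y)) (dotZr a p x))).

Section Subdifferential.
Context {R : realType} {n : nat}.
Local Notation V := 'rV[R]_n.
Variable f : V -> \bar R.
Hypotheses (fcc : closed_convex f) (f_ge0 : forall x, (0 <= f x)%E).
Hypothesis fdom : effdom f !=set0.

(** The pairs [(y, p)] where [p] is not a subgradient at [y] form an open set: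
    the violated inequality [f z < f y + dot (z - y) p] persists near [(y, p)]
    by lower semicontinuity. Compactness of [K] makes the neighborhood of [x]
    uniform in [p]. *)
Lemma near_subdiff_disjoint (K : set V) x : compact K ->
  (forall p, K p -> ~ subdiff f x p) ->
  \forall y \near x, forall p, K p -> ~ subdiff f y p.
Proof.
move=> /compact_near_coveringP cK Kx; have [fNy _ flsc] := fcc.
apply: (cK _ (nbhs x) (fun y p => ~ subdiff f y p)) => p Kp.
have [z fz] : exists z, (f z < f x + (dot (z - x) p)%:E)%E.
  have := Kx _ Kp; rewrite /subdiff /=.
  have := fNy x; case: (f x) => [a| |]// _ nsub.
  have [z /negP] : exists z, ~ (a%:E + (dot (z - x) p)%:E <= f z)%E.
    by apply/existsNP => sub; apply: nsub.
  by rewrite -ltNge; exists z.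
pose g (q : V * V) := (f q.2 + (dot (z - q.2) q.1)%:E)%E.
have glsc : lower_semicontinuous g.
  apply: (@lscD _ _ (f \o snd)) => [q| |q]; first exact: fNy.
    exact: (lsc_comp flsc (@snd_continuous _ _)).
  have cz := continuous_comp (@snd_continuous _ _ q)
    (@continuous_subl _ _ z q.2).
  exact: (continuous_dot cz (@fst_continuous _ _ q)).
move: fz; have := fNy z; case fzE: (f z) => [b| |]// _ bg; last first.
  by move: bg; rewrite ltNge leey.
have [W Wpx Wb] := glsc (p, x) b bg.
apply: filterS Wpx => -[q y] /Wb /= bqy [_ /(_ z)]; rewrite fzE.
by move=> /(lt_le_trans bqy); rewrite ltxx.
Qed.

(** Moving from [y] by [r] in the direction of a coordinate of [p], [f]
    increases by at least [r] times its absolute value, while [0 <= f <= M]. *)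
Lemma subdiff_bounded (M r : R) x y p : 0 < r ->
  (forall z, `|x - z| < 2 * r -> (f z <= M%:E)%E) ->
  `|x - y| < r -> subdiff f y p -> `|p| <= M / r.
Proof.
move=> r0 fM xy [fy sub].
have fy0 : 0 <= fine (f y) by exact: fine_ge0.
have key i (s : R) : `|s| = 1 -> s * p 0 i <= M / r.
  move=> s1; pose v : V := (r * s) *: delta_mx 0 i.
  have vr : `|v| <= r.
    apply: norm_le_coord => [|j]; first exact: ltW.
    rewrite !mxE eqxx normrM normrM s1 mulr1 (gtr0_norm r0) ger_pMr//=.
    by case: (_ == _); rewrite ?normr0 ?normr1.
  have yv : y + v - y = v by rewrite addrC addKr.
  have := le_trans (sub (y + v)) (fM (y + v) _).
  rewrite yv dotC dotZr dot_delta -(fineK fy) -EFinD lee_fin => H.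
  have {}H : r * (s * p 0 i) <= M.
    rewrite mulrA; apply: le_trans (H _); first by rewrite lerDr.
    rewrite opprD addrA (le_lt_trans (ler_normB _ _))//; lra.
  by rewrite ler_pdivlMr// mulrC.
apply: norm_le_coord => [|i].
  have /= := fM x; rewrite subrr normr0 => /(_ _)/(le_trans (f_ge0 x)).
  rewrite lee_fin => M0; rewrite divr_ge0 ?(ltW r0)// M0//; lra.
rewrite ler_norml; have := key i 1; have := key i (-1).
rewrite normrN normr1 => /(_ erefl) ? /(_ erefl) ?; apply/andP; split; lra.
Qed.

Section Interior.
Variable (M : R).
Hypothesis fM : forall x, effdom f x -> (f x <= M%:E)%E.

(** Near [x] the subgradients stay in a compact ball ([subdiff_bounded]), so
    only the compact part of the ball outside [U] has to be avoided. *)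
Lemma subdiff_usc (U : set V) x : (effdom f)° x -> open U ->
  subdiff f x `<=` U -> \forall y \near x, subdiff f y `<=` U.
Proof.
move=> /nbhs_ballP[d /= d0 dO] oU xU.
have d20 : 0 < d / 2 by lra.
pose K := [set p : V | `|p| <= M / (d / 2)] `&` ~` U.
have cK : compact K.
  apply: bounded_closed_compact.
    exists (M / (d / 2)); split; first exact: num_real.
    by move=> t dt p [/= pd _]; apply: le_trans (ltW dt).
  apply: closedI; last exact: open_closedC.
  apply: (@closed_comp _ _ (fun p : V => `|p|) [set t | t <= M / (d / 2)]).
    by move=> z _; exact: norm_continuous.
  exact: closed_le.
have : \forall y \near x, forall p, K p -> ~ subdiff f y p.
  by apply: near_subdiff_disjoint => // p [_ nUp] /xU.
have : \forall y \near x, `|x - y| < d / 2.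
  by apply/nbhs_ballP; exists (d / 2) => //= y; rewrite -ball_normE.
apply: filterS2 => y xy Ky p yp; apply: contrapT => nUp.
apply: (Ky p) => //; split=> //=.
apply: subdiff_bounded (xy) (yp) => // z xz; apply/fM/dO.
by rewrite -ball_normE /=; lra.
Qed.

(** If there were no subgradient at [x], there would be none around [x]
    ([subdiff_usc] with [U] empty), against the density of such points. *)
Lemma subdiff_interior_nonempty x : (effdom f)° x -> subdiff f x !=set0.
Proof.
move=> xO; apply: contrapT => /nonemptyPn x0.
have : subdiff f x `<=` set0 by rewrite x0.
move=> /(subdiff_usc xO open0) /nbhs_ballP[d /= d0 dx].
have [y [p [xy yp]]] := subdiff_dense fcc f_ge0 fdom (interior_subset xO) d0.
have := dx y _ p yp; rewrite -ball_normE; exact.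
Qed.

(** For a subgradient [q] at [x + v], the error [f (x + v) - f x - dot p v]
    lies between [0] and [dot (q - p) v], and [q] is close to [p] by
    [subdiff_usc]. *)
Lemma gradient_unique_subdiff x p : (effdom f)° x ->
  subdiff f x = [set p] -> gradient (fine \o f) x = p.
Proof.
move=> xO xp.
apply/rowP => i; rewrite mxE.
rewrite (@diff_unique R V R (fine \o f) (dot p) x) /= ?dot_delta//.
  move=> z; apply: (@continuous_dot _ _ _ (cst p) id).
  - exact: cst_continuous.
  - exact: cvg_id.
apply/eqaddoP => _/posnumP[e].
have e0 : 0 < e%:num / n.+1%:R by [].
have : subdiff f x `<=` ball p (e%:num / n.+1%:R).
  by rewrite xp => _ ->; exact: ballxx.
move=> /(subdiff_usc xO (ball_open _ _)).
have : \forall y \near x, (effdom f)° y by exact: nbhs_interior.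
move=> /filterI/[apply] /nbhs_ballP[d /= d0 dP].
apply/nbhs_ballP; exists d => //= v; rewrite -ball_normE /= sub0r normrN => vd.
have [|xvO sube] := dP (v + x).
  by rewrite -ball_normE /= opprD addrCA subrr addr0 normrN.
have [q xvq] := subdiff_interior_nonempty xvO.
have {sube} := sube _ xvq; rewrite -ball_normE /= => pq.
have : subdiff f x p by rewrite xp.
move: xvq => [fxv /(_ x)]; rewrite opprD addrCA subrr addr0 => qx.
move=> [fx /(_ (v + x))]; rewrite addrK => px.
rewrite !fctE /=.
move: qx px; rewrite -(fineK fxv) -(fineK fx) -!EFinD !lee_fin /=.
rewrite -scaleN1r dotZl mulN1r (dotC v q) (dotC v p) => qx px.
rewrite ger0_norm; last lra.
have := le_trans (ler_norm _) (dot_le_norm (q - p) v).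
rewrite dotBl (distrC q) => H.
apply: (@le_trans _ _ (n%:R * (`|p - q| * `|v|))); first lra.
rewrite mulrA ler_wpM2r//.
apply: (@le_trans _ _ (n.+1%:R * (e%:num / n.+1%:R))).
  by rewrite ler_pM// ?ler_nat// ltW.
by rewrite mulrCA divff// mulr1.
Qed.

End Interior.
End Subdifferential.
(** * Null sets *)

Section OuterMeasure.
Context {T : Type} {R : realType} (mu : {outer_measure set T -> \bar R}).
Local Open Scope ereal_scope.

Lemma outer_measure_finite_cover (I : finType) (F : I -> set T) (A : set T) :
  (forall x, A x -> exists i, F i x) -> mu A <= \sum_i mu (F i).
Proof.
move=> AF; apply: (@le_trans _ _ (mu (\big[setU/set0]_(i : I) F i))).
  apply: le_outer_measure => x /AF[i Fix].
  by rewrite -classical_sets.bigcup_seq; exists i => //=; rewrite mem_index_enum.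
elim/big_ind2 : _ => [|A' a B' b Aa Bb|//]; first by rewrite outer_measure0.
exact: le_trans (outer_measureU2 _ _ _) (leeD Aa Bb).
Qed.

Lemma outer_measure_bigcup0 (F : nat -> set T) :
  (forall k, mu (F k) = 0) -> mu (\bigcup_k F k) = 0.
Proof.
move=> F0; apply/eqP; rewrite eq_le outer_measure_ge0 andbT.
by rewrite (le_trans (outer_measure_sigma_subadditive mu F))// eseries0.
Qed.

Lemma outer_measure_countable0 (I : countType) (F : I -> set T) :
  (forall i, mu (F i) = 0) -> mu (\bigcup_i F i) = 0.
Proof.
move=> F0; pose G k := if unpickle k is Some i then F i else set0.
apply/eqP; rewrite eq_le outer_measure_ge0 andbT.
rewrite -(@outer_measure_bigcup0 G) => [|k]; last first.
  by rewrite /G; case: unpickle => // ; exact: outer_measure0.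
apply: le_outer_measure => x [i _ Fix].
by exists (pickle i) => //; rewrite /G pickleK.
Qed.

End OuterMeasure.

Section NullSets.
Context {R : realType} {n : nat}.
Local Notation V := 'rV[R]_n.+1.
Local Notation mu := (lebesgue_outer_measure R n).
Local Open Scope ereal_scope.

Lemma box_volume_ge0 (ab : V * V) : (0 <= box_volume ab)%R.
Proof. by apply: prodr_ge0 => i _; rewrite le_max lexx. Qed.

Lemma lebesgue_outer_box (ab : V * V) : mu (box ab) <= (box_volume ab)%:E.
Proof.
pose I (k : nat) : V * V := if k is 0%N then ab else (0%R, 0%R).
apply: ereal_inf_lbound; exists I; first by move=> x abx; exists 0%N.
rewrite nneseries_recl//; last by move=> k _; rewrite lee_fin box_volume_ge0.
rewrite eseries0 ?adde0// => -[|k] // _ _; congr EFin.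
by rewrite /box_volume (bigD1 ord0)//= subrr maxxx mul0r.
Qed.

(** The cube of side [2 * K] in the hyperplane orthogonal to the [i]-th axis is
    cut in [m.+1 ^ n] cells of side [h].  Over each cell the graph fits in a box
    whose [n.+1] sides are all proportional to [h = 2 * K / m.+1], so that the
    total volume is of the order of [1 / m.+1]. *)
Lemma lipschitz_graph_bounded_le (S : set V) (i : 'I_n.+1) (C K : R) (m : nat) :
  (0 <= C)%R -> (0 < K)%R ->
  (forall x, S x -> `|x| < K)%R ->
  (forall x y r, S x -> S y -> 0 <= r ->
    (forall j, `|x 0 (lift i j) - y 0 (lift i j)| <= r) ->
    `|x 0 i - y 0 i| <= C * r)%R ->
  mu S <= ((4 * K) ^+ n * ((2 * C + 1) * (2 * K)) / m.+1%:R)%:E.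
Proof.
move=> C0 K0 SK SC; pose h := (2 * K / m.+1%:R)%R.
have h0 : (0 < h)%R by rewrite divr_gt0//; lra.
have mh : (m.+1%:R * h = 2 * K)%R by rewrite /h mulrCA divff// mulr1.
pose cell (a : {ffun 'I_n -> 'I_m.+1}) : set V := [set x | S x /\ forall j,
  (((a j)%:R * h <= x 0 (lift i j) + K) &&
   (x 0 (lift i j) + K <= (a j).+1%:R * h))%R].
pose s a : V := xget 0%R (cell a).
(* The lower bounds are lowered by [h] since boxes are open on the left. *)
pose bx (a : {ffun 'I_n -> 'I_m.+1}) : V * V :=
  (\row_j if unlift i j is Some k then (a k)%:R * h - K - h
          else s a 0 i - (C + 1) * h,
   \row_j if unlift i j is Some k then (a k).+1%:R * h - K
          else s a 0 i + C * h)%R.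
have cover x : S x -> exists a, box (bx a) x.
  move=> Sx.
  have xK j : (- K < x 0 j < K)%R.
    by rewrite -ltr_norml; apply: le_lt_trans (SK _ Sx); exact: coord_le_norm.
  pose a : {ffun 'I_n -> 'I_m.+1} :=
    [ffun j => inord (Num.truncn ((x 0 (lift i j) + K) / h)%R)].
  have cx : cell a x.
    split=> // j; have /andP[x1 x2] := xK (lift i j).
    have t0 : (0 <= (x 0 (lift i j) + K) / h)%R.
      by rewrite divr_ge0 ?(ltW h0)//; lra.
    have aj : nat_of_ord (a j) = Num.truncn ((x 0 (lift i j) + K) / h)%R.
      rewrite ffunE inordK// truncn_lt_nat// ltr_pdivrMr// mh; lra.
    have /andP[] := truncn_itv t0; rewrite -aj ler_pdivlMr// ltr_pdivrMr//.
    by move=> -> /ltW ->.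
  exists a.
  have [Sa ca] : cell a (s a) by apply: (xgetI 0%R); exact: cx.
  have [_ cax] := cx.
  have xs : (`|x 0 i - s a 0 i| <= C * h)%R.
    apply: SC => // [|j]; first exact: ltW.
    have /andP[] := ca j; have /andP[] := cax j.
    rewrite -[(a j).+1]addn1 natrD mulrDl mul1r ler_norml => *.
    by apply/andP; split; lra.
  move=> j; rewrite in_itv /= !mxE.
  case: unliftP => [k ->|->].
    have /andP[] := cax k.
    by move=> *; apply/andP; split; lra.
  by move: xs; rewrite ler_norml => /andP[] *; apply/andP; split; lra.
have vol a : box_volume (bx a) = ((2 * h) ^+ n * ((2 * C + 1) * h))%R.
  rewrite /box_volume (bigD1_ord i)//= mulrC !mxE unlift_none.
  congr (_ * _)%R; last by rewrite max_r; nra.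
  rewrite (eq_bigr (fun=> 2 * h)%R); first by rewrite prodr_const card_ord.
  move=> j _; rewrite !mxE liftK -[(a j).+1]addn1 natrD mulrDl mul1r max_r; lra.
apply: le_trans (outer_measure_finite_cover mu cover) _.
apply: (@le_trans _ _ (\sum_(a : {ffun 'I_n -> 'I_m.+1})
    ((2 * h) ^+ n * ((2 * C + 1) * h))%:E)).
  by apply: lee_sum => a _; rewrite -(vol a); exact: lebesgue_outer_box.
rewrite sumEFin lee_fin sumr_const card_ffun !card_ord -[leLHS]mulr_natl natrX.
rewrite [leLHS]mulrA -exprMn (mulrCA m.+1%:R) mh (_ : 2 * (2 * K) = 4 * K)%R.
  by rewrite /h !mulrA.
by lra.
Qed.

Lemma lipschitz_graph_null (S : set V) (i : 'I_n.+1) (C : R) : (0 <= C)%R ->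
  (forall x y r, S x -> S y -> 0 <= r ->
    (forall j, `|x 0 (lift i j) - y 0 (lift i j)| <= r) ->
    `|x 0 i - y 0 i| <= C * r)%R ->
  mu S = 0.
Proof.
move=> C0 SC.
have SE : S = \bigcup_k (S `&` [set x | `|x| < k.+1%:R]%R).
  apply/seteqP; split=> [x Sx|x [k _ []]//].
  exists (Num.truncn `|x|) => //; split=> //=.
  by have /andP[] := truncn_itv (normr_ge0 x).
rewrite SE; apply: outer_measure_bigcup0 => k.
apply/eqP; rewrite eq_le outer_measure_ge0 andbT.
apply/lee_addgt0Pr => e e0; rewrite add0e.
set A := ((4 * k.+1%:R) ^+ n * ((2 * C + 1) * (2 * k.+1%:R)))%R.
have A0 : (0 <= A)%R.
  rewrite mulr_ge0// ?exprn_ge0// ?mulr_ge0//; lra.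
apply: le_trans (@lipschitz_graph_bounded_le _ i C k.+1%:R
  (Num.truncn (A / e)) C0 _ _ _) _ => //.
- by move=> x [].
- by move=> x y r [Sx _] [Sy _]; exact: SC.
rewrite lee_fin -/A ler_pdivrMr// mulrC -ler_pdivrMr//.
by have /andP[_ /ltW] := truncn_itv (divr_ge0 A0 (ltW e0)).
Qed.

End NullSets.
Section SingularSet.
Context {R : realType} {n : nat}.
Local Notation V := 'rV[R]_n.+1.
Local Notation mu := (lebesgue_outer_measure R n).

Lemma subdiff_monotone (f : V -> \bar R) x y p q :
  subdiff f x p -> subdiff f y q -> 0 <= dot (p - q) (x - y).
Proof.
move=> [fx /(_ y)] + [fy /(_ x)].
rewrite -(fineK fx) -(fineK fy) -!EFinD !lee_fin.
by rewrite !(dotC _ p) !(dotC _ q) dotBl !dotBr; lra.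
Qed.

(** Zajicek's argument. Let [p <> q] be subgradients at [x], with [p i < q i]
    for the coordinate [i], and approximate them by rational vectors [a] and
    [b] up to a quarter of [b i - a i]. At two points [x] and [y] with the same
    data [(i, (a, b))], monotonicity applied to a subgradient near [b] at [x]
    and one near [a] at [y] bounds [y i - x i] by a multiple of the other
    coordinates of [x - y]; by symmetry these points lie on a Lipschitz graph
    over the hyperplane orthogonal to the [i]-th axis. There are countably many
    data. *)
Lemma subdiff_multi_null (f : V -> \bar R) :
  mu [set x | exists p q, [/\ subdiff f x p, subdiff f x q & p <> q]] = 0%E.
Proof.
pose I := ('I_n.+1 * ('rV[rat]_n.+1 * 'rV[rat]_n.+1))%type.
pose d (t : I) j : R := ratr (t.2.2 0 j) - ratr (t.2.1 0 j).
pose S (t : I) := [set x | 0 < d t t.1 /\ exists p q : V,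
  [/\ subdiff f x p, subdiff f x q,
      forall j, `|p 0 j - ratr (t.2.1 0 j)| <= d t t.1 / 4 &
      forall j, `|q 0 j - ratr (t.2.2 0 j)| <= d t t.1 / 4]].
apply/eqP; rewrite eq_le outer_measure_ge0 andbT.
have <- : mu (\bigcup_t S t) = 0%E.
  apply: outer_measure_countable0 => t.
  have [d0|d0] := ltP 0 (d t t.1); last first.
    rewrite (_ : S t = set0) ?outer_measure0//.
    by apply/seteqP; split=> // x []; rewrite ltNge d0.
  pose B := \sum_(j < n) (`|d t (lift t.1 j)| + d t t.1 / 2).
  have B0 : 0 <= B by apply: sumr_ge0 => j _; rewrite addr_ge0//; lra.
  have key x y r : S t x -> S t y -> 0 <= r ->
      (forall j, `|x 0 (lift t.1 j) - y 0 (lift t.1 j)| <= r) ->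
      y 0 t.1 - x 0 t.1 <= (2 * B / d t t.1) * r.
    move=> [_ [_ [q [_ xq _ qb]]]] [_ [p [_ [yp _ pa _]]]] r0 xyr.
    have := subdiff_monotone xq yp; rewrite /dot (bigD1_ord t.1)//= !mxE.
    set s := \sum_(j < n) _.
    have sB : s <= B * r.
      rewrite mulr_suml; apply: ler_sum => j _; rewrite !mxE.
      apply: le_trans (ler_norm _) _; rewrite normrM ler_pM//.
      have := qb (lift t.1 j); have := pa (lift t.1 j).
      have := ler_norm (d t (lift t.1 j)).
      have := ler_norm (- d t (lift t.1 j)); rewrite normrN.
      rewrite /d !ler_norml => ? ? /andP[? ?] /andP[? ?].
      by apply/andP; split; lra.
    have gd : d t t.1 / 2 <= q 0 t.1 - p 0 t.1.
      have : d t t.1 = ratr (t.2.2 0 t.1) - ratr (t.2.1 0 t.1) by [].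
      move: (qb t.1) (pa t.1); rewrite !ler_norml; move: (d t t.1) => D.
      by move=> /andP[? ?] /andP[? ?] ?; lra.
    set w := y 0 t.1 - x 0 t.1.
    have -> : x 0 t.1 - y 0 t.1 = - w by rewrite opprB.
    rewrite mulrN addrC subr_ge0 => gw.
    rewrite mulrAC ler_pdivlMr// -subr_ge0.
    have [w0|w0] := ltP 0 w; last first.
      rewrite subr_ge0 -mulrA; apply: le_trans (mulr_le0_ge0 w0 (ltW d0)) _.
      by rewrite !mulr_ge0.
    have : d t t.1 / 2 * w <= (q 0 t.1 - p 0 t.1) * w by rewrite ler_pM2r.
    move=> /le_trans/(_ gw)/le_trans/(_ sB); rewrite mulrC mulrA ler_pdivrMr//.
    by rewrite subr_ge0 => /le_trans; apply; rewrite mulrC mulrA.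
  apply: (@lipschitz_graph_null _ _ _ t.1 (2 * B / d t t.1)).
    by rewrite divr_ge0 ?(ltW d0)// mulr_ge0.
  move=> x y r Sx Sy r0 xyr; rewrite ler_norml; apply/andP; split.
    by rewrite lerNl opprB; exact: key xyr.
  by apply: key => // j; rewrite distrC.
apply: le_outer_measure => x [p [q [xp xq pq]]].
have [i pqi] : exists i, p 0 i <> q 0 i.
  by apply/existsNP => pq'; apply: pq; apply/rowP => i; exact: pq'.
wlog pqlt : p q xp xq pq pqi / p 0 i < q 0 i.
  move=> wl; have [|qp|//] := ltgtP (p 0 i) (q 0 i); first exact: wl.
  by apply: (wl q p) => // /esym.
(* With errors at most [e], [b i - a i] is at least [8 * e - 2 * e], whose
   quarter is more than [e]. *)
set e := (q 0 i - p 0 i) / 8.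
have e0 : 0 < e by rewrite divr_gt0// subr_gt0.
have /choice[a pa] (j : 'I_n.+1) : exists a : rat, `|p 0 j - ratr a| <= e.
  have /rat_in_itvoo[a] : p 0 j - e < p 0 j + e by lra.
  rewrite in_itv/= => /andP[? ?]; exists a; rewrite ler_norml.
  by apply/andP; split; lra.
have /choice[b qb] (j : 'I_n.+1) : exists b : rat, `|q 0 j - ratr b| <= e.
  have /rat_in_itvoo[b] : q 0 j - e < q 0 j + e by lra.
  rewrite in_itv/= => /andP[? ?]; exists b; rewrite ler_norml.
  by apply/andP; split; lra.
exists (i, (\row_j a j, \row_j b j)) => //; rewrite /S /d /= !mxE.
have : 8 * e = q 0 i - p 0 i by rewrite /e mulrC divfK.
have := pa i; have := qb i; rewrite !ler_norml => /andP[? ?] /andP[? ?] ?.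
split; first lra.
exists p, q; split=> // j; rewrite mxE.
- by apply: le_trans (pa j) _; lra.
- by apply: le_trans (qb j) _; lra.
Qed.

End SingularSet.
Section Boundary.
Context {R : realType} {n : nat}.
Local Notation V := 'rV[R]_n.+1.
Local Notation mu := (lebesgue_outer_measure R n).
Variable Omega : set V.
Hypotheses (Oconv : convex_set Omega) (Oclosed : closed Omega).
Hypothesis O0 : Omega !=set0.

(** The indicator function of convex analysis; its subgradients are the normal
    vectors to [Omega]. *)
Definition set_indicator (x : V) : \bar R := if x \in Omega then 0%E else +oo%E.

Let set_indicatorE x : Omega x -> set_indicator x = 0%E.
Proof. by rewrite /set_indicator => Ox; rewrite mem_set. Qed.

Let set_indicator_le x (r : R) :
  (set_indicator x <= r%:E)%E <-> Omega x /\ 0 <= r.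
Proof.
rewrite /set_indicator; have [/set_mem Ox|/negP nOx] := boolP (x \in Omega).
  by rewrite lee_fin; split=> [|[]].
by rewrite leye_eq; split=> // -[/mem_set].
Qed.

Let set_indicator_ge0 x : (0 <= set_indicator x)%E.
Proof. by rewrite /set_indicator; case: ifP => // _; rewrite leey. Qed.

Let set_indicator_dom : effdom set_indicator !=set0.
Proof.
by have [x Ox] := O0; exists x; rewrite /effdom /= set_indicatorE ?ltry.
Qed.

Lemma set_indicator_closed_convex : closed_convex set_indicator.
Proof.
split.
- by move=> x; apply: lt_le_trans (set_indicator_ge0 x).
- move=> [x a] [y b] t; rewrite !inE /epigraph /=.
  move=> /set_indicator_le[Ox a0] /set_indicator_le[Oy b0].
  apply/set_indicator_le; split.
    by have := Oconv t (mem_set Ox) (mem_set Oy); rewrite inE.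
  by rewrite /conv /= addr_ge0// mulr_ge0// /unstable.onem subr_ge0.
- move=> x a ax; have [Ox|nOx] := pselect (Omega x).
    rewrite set_indicatorE// in ax.
    exists setT; first exact: filterT.
    by move=> y _; exact: lt_le_trans ax _.
  exists (~` Omega).
    by apply: open_nbhs_nbhs; split=> //; exact: closed_openC.
  by move=> y nOy; rewrite /set_indicator memNset// ltry.
Qed.

(** An exterior point [y] near [x] has a projection [z] on [Omega], given by
    [prox_subdiff], and [y - z] is a nonzero normal vector at [z].  Once
    normalized, it lies in the compact unit sphere: if this sphere contained no
    normal vector at [x], it would contain none at points near [x]
    ([near_subdiff_disjoint]). *)
Lemma boundary_normal x : Omega x -> ~ Omega° x ->
  exists2 p, p <> 0 & subdiff set_indicator x p.
Proof.
move=> Ox nOx; apply: contrapT => nex.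
have icc := set_indicator_closed_convex.
have cK : compact [set p : V | `|p| = 1].
  apply: bounded_closed_compact.
    exists 1; split; first exact: num_real.
    by move=> t t1 p /= ->; exact: ltW.
  apply: (@closed_comp _ _ (fun p : V => `|p|) [set t | t = 1]).
    by move=> z _; exact: norm_continuous.
  exact: closed_eq.
have : \forall y \near x, forall p : V, `|p| = 1 -> ~ subdiff set_indicator y p.
  apply: (near_subdiff_disjoint icc set_indicator_dom cK) => p /= p1 xp.
  by apply: nex; exists p => // p0; move: p1; rewrite p0 normr0; lra.
move=> /nbhs_ballP[d /= d0 dx].
(* The norm is the sup norm, so that projecting in the Euclidean norm may
   multiply distances by up to [n.+1]. *)
pose e := d / n.+2%:R.
have e0 : 0 < e by rewrite divr_gt0.
have de : d = e + n.+1%:R * e.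
  by rewrite -[X in X + _]mul1r -mulrDl nat1r /e mulrC divfK.
have [y nOy xy] : exists2 y, ~ Omega y & `|x - y| < e.
  apply: contrapT => H; apply: nOx; apply/nbhs_ballP; exists e => //= y.
  by rewrite -ball_normE /= => xy; apply: contrapT => nOy; apply: H; exists y.
have [z [zp zmin]] :=
  prox_subdiff icc set_indicator_ge0 set_indicator_dom y ltr01.
have Oz : Omega z.
  by move: zp => [+ _]; rewrite /set_indicator; case: ifP => //; rewrite inE.
have yz : `|y - z| <= n.+1%:R * `|x - y|.
  rewrite -ler_sqr ?nnegrE ?mulr_ge0//.
  apply: le_trans (norm_sqr_le_dot _) _.
  have := zmin x; rewrite !set_indicatorE// !add0e !mul1r lee_fin => /le_trans.
  apply; apply: le_trans (ler_norm _) _; apply: le_trans (dot_le_norm _ _) _.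
  rewrite (distrC y) exprMn -expr2 ler_wpM2r ?sqr_ge0// expr2 ler_peMl//.
  by rewrite ler1n.
have p0 : 0 < `|2 * 1 *: (y - z)|.
  rewrite normr_gt0 scaler_eq0 mulr1 pnatr_eq0 /= subr_eq0.
  by apply/eqP => yz'; apply: nOy; rewrite yz'.
set p := 2 * 1 *: (y - z) in zp p0.
apply: (dx z _ (`|p|^-1 *: p)).
- rewrite -ball_normE /=.
  have -> : x - z = (x - y) + (y - z) by rewrite addrA subrK.
  apply: le_lt_trans (ler_normD _ _) _; rewrite de ltr_leD//.
  by apply: le_trans yz _; rewrite ler_pM2l// ltW.
- by rewrite normrZ normfV normr_id mulVf// gt_eqF.
- move: zp => [zfin sub]; split=> // q; have := sub q.
  rewrite set_indicatorE// !add0e (dotZr `|p|^-1) /set_indicator.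
  case: ifP => _; last by move=> _; exact: leey.
  by rewrite !lee_fin pmulr_rle0// invr_gt0.
Qed.

(** On the boundary, the indicator function has a nonzero subgradient besides
    [0]. *)
Lemma convex_boundary_null : mu (Omega `\` Omega°) = 0%E.
Proof.
apply/eqP; rewrite eq_le outer_measure_ge0 andbT.
rewrite -(subdiff_multi_null set_indicator); apply: le_outer_measure.
move=> x [Ox nOx]; have [p p0 xp] := boundary_normal Ox nOx.
exists p, 0; split=> //; split; first by rewrite set_indicatorE.
by move=> q; rewrite dotC dot0l adde0 set_indicatorE.
Qed.

End Boundary.
(** * Lebesgue measurability of Borel sets and of null sets *)

Section LebesgueMeasurable.
Context {R : realType} {n : nat}.
Local Notation V := 'rV[R]_n.+1.
Local Notation mu := (lebesgue_outer_measure R n).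

(** A half-space cuts every box in two boxes whose volumes add up. *)
Lemma half_space_measurable (i : 'I_n.+1) (c : R) :
  measurable ([set x : V | x 0 i <= c] : set (lebesgueType R n)).
Proof.
apply: le_caratheodory_measurable => X.
apply: le_ereal_inf_tmp => _ [I XI <-].
pose lo (ab : V * V) : V * V :=
  (ab.1, \row_j if j == i then Num.min (ab.2 0 j) c else ab.2 0 j).
pose hi (ab : V * V) : V * V :=
  (\row_j if j == i then Num.max (ab.1 0 j) c else ab.1 0 j, ab.2).
have vol ab : (box_volume ab)%:E =
    ((box_volume (lo ab))%:E + (box_volume (hi ab))%:E)%E.
  rewrite -EFinD; congr EFin.
  rewrite /box_volume (bigD1 i)//= [X in _ = X + _](bigD1 i)//=.
  rewrite [X in _ = _ + X](bigD1 i)//= !mxE eqxx.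
  have E1 : \prod_(j < n.+1 | j != i) Num.max 0 ((lo ab).2 0 j - ab.1 0 j) =
      \prod_(j < n.+1 | j != i) Num.max 0 (ab.2 0 j - ab.1 0 j).
    by apply: eq_bigr => j /negbTE ji; rewrite mxE ji.
  have E2 : \prod_(j < n.+1 | j != i) Num.max 0 (ab.2 0 j - (hi ab).1 0 j) =
      \prod_(j < n.+1 | j != i) Num.max 0 (ab.2 0 j - ab.1 0 j).
    by apply: eq_bigr => j /negbTE ji; rewrite mxE ji.
  rewrite [X in _ = _ * X + _]E1 [X in _ = _ + _ * X]E2 -mulrDl; congr (_ * _).
  rewrite /Num.max /Num.min.
  case: (ltP (ab.2 0 i) c) => ?; case: (ltP (ab.1 0 i) c) => ?;
    by repeat case: ltP => ?; lra.
under eq_eseriesr do rewrite vol.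
rewrite nneseriesD; [|by move=> k _ _; rewrite lee_fin box_volume_ge0..].
apply: leeD; apply: ereal_inf_lbound.
- exists (fun k => lo (I k)) => // x [/XI[k _ Ix] xc].
  exists k => // j; have := Ix j; rewrite !in_itv /= mxE => /andP[-> xb].
  by case: eqP => [ji|//]; rewrite le_min xb ji xc.
- exists (fun k => hi (I k)) => // x [/XI[k _ Ix] /negP]; rewrite -ltNge => xc.
  exists k => // j; have := Ix j; rewrite !in_itv /= mxE => /andP[xa ->].
  by case: eqP => [ji|//]; rewrite ?gt_max xa ?ji ?xc.
Qed.

Lemma box_measurable (ab : V * V) :
  measurable (box ab : set (lebesgueType R n)).
Proof.
rewrite (_ : box ab = \bigcap_(i in [set: 'I_n.+1])
    ([set x : V | x 0 i <= ab.2 0 i] `\` [set x : V | x 0 i <= ab.1 0 i])).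
  apply: (@fin_bigcap_measurable _ (lebesgueType R n)) => // i _.
  by apply: measurableD; exact: half_space_measurable.
apply/seteqP; split=> x abx i.
- move=> _; have := abx i; rewrite in_itv /= => /andP[ax xb].
  by split=> //=; apply/negP; rewrite -ltNge.
- by have [//= xb /negP] := abx i I; rewrite -ltNge in_itv /= => ->.
Qed.

(** An open set is the union of the boxes with rational vertices it contains. *)
Lemma open_lebesgue_measurable (U : set V) : open U ->
  measurable (U : set (lebesgueType R n)).
Proof.
move=> oU; pose B (t : 'rV[rat]_n.+1 * 'rV[rat]_n.+1) : set V :=
  box (map_mx ratr t.1, map_mx ratr t.2).
pose D := [set t | B t `<=` U].
rewrite (_ : U = \bigcup_t (if t \in D then B t else set0)).
  apply: (@countable_bigcupT_measurable _ (lebesgueType R n)) => //= t.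
  by case: ifP => // _; exact: box_measurable.
apply/seteqP; split=> x; last by move=> [t _]; case: ifP => // /set_mem; exact.
move=> Ux; have /nbhs_ballP[d /= d0 dU] : nbhs x U by exact: open_nbhs_nbhs.
have /choice[a xa] (j : 'I_n.+1) :
    exists a : rat, x 0 j - d / 2 < ratr a < x 0 j.
  have /rat_in_itvoo[a] : x 0 j - d / 2 < x 0 j by lra.
  by rewrite in_itv; exists a.
have /choice[b xb] (j : 'I_n.+1) :
    exists b : rat, x 0 j < ratr b < x 0 j + d / 2.
  have /rat_in_itvoo[b] : x 0 j < x 0 j + d / 2 by lra.
  by rewrite in_itv; exists b.
have Dab : (\row_j a j, \row_j b j) \in D.
  apply/mem_set => y yab; apply: dU; rewrite -ball_normE /=.
  apply: (@le_lt_trans _ _ (d / 2)); last lra.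
  apply: norm_le_coord => [|j]; first lra.
  have := yab j; have := xa j; have := xb j.
  rewrite in_itv /= !mxE ler_norml => /andP[? ?] /andP[? ?] /andP[? ?].
  by apply/andP; split; lra.
exists (\row_j a j, \row_j b j) => //; rewrite Dab => j.
rewrite in_itv /= !mxE; have /andP[_ ->] := xa j.
by have /andP[/ltW -> _] := xb j.
Qed.

Lemma null_lebesgue_measurable (N : set V) : mu N = 0%E ->
  measurable (N : set (lebesgueType R n)).
Proof.
move=> N0; apply: le_caratheodory_measurable => X.
apply: (@le_trans _ _ (mu N + mu X)%E); last by rewrite N0 add0e.
by apply: leeD; apply: le_outer_measure => x [].
Qed.

End LebesgueMeasurable.
(** * The integrals *)

Section SetFunction.
Import HBNNSimple.

(** Simple functions only see measurable sets; plain set functions are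
    considered here because of [hessian0]. *)
Lemma eq_setfun_integral d (T : measurableType d) (R : realType)
    (m1 m2 : set T -> \bar R) (D : set T) (f : T -> \bar R) :
  (forall A, measurable A -> m1 A = m2 A) ->
  integral m1 D f = integral m2 D f.
Proof.
move=> m12; rewrite /integral.
have m12s (h : {nnsfun T >-> R}) : sintegral m1 h = sintegral m2 h.
  by apply: eq_fsbigr => r _; rewrite m12.
by congr (ereal_sup _ - ereal_sup _)%E; apply: eq_imagel => h _; exact: m12s.
Qed.

End SetFunction.

Lemma ge0_integral_mrestr d (T : measurableType d) (R : realType)
    (mu : {measure set T -> \bar R}) (D : set T) (mD : measurable D)
    (f : T -> \bar R) :
  measurable_fun setT f -> (forall x, 0 <= f x)%E ->
  (\int[mrestr mu mD]_x f x = \int[mu]_(x in D) f x)%E.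
Proof.
move=> mf f0.
have DC0 : mrestr mu mD (~` D) = 0%E by rewrite /mrestr setICl measure0.
rewrite (ge0_negligible_integral (measurableC mD) measurableT mf _ DC0)//.
rewrite setTD setCK; apply: eq_measure_integral => A mA AD.
by rewrite /= /mrestr setIidl.
Qed.

Section Borel.
Context {R : realType} {n : nat}.
Local Notation V := 'rV[R]_n.+1.

Lemma open_borel_measurable (U : set V) : open U ->
  measurable (U : set (borelType R n)).
Proof. by move=> oU; exact: sub_sigma_algebra. Qed.

Lemma continuous_borel_measurable (g : V -> R) : continuous g ->
  measurable_fun [set: borelType R n] (g : borelType R n -> R).
Proof.
move=> /continuousP cg; apply: (measurability _ (RGenOpens.measurableE R)).
move=> _ [_ [a [b ->] <-]]; rewrite setTI; apply: open_borel_measurable.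
exact/cg/interval_open.
Qed.

End Borel.

Section ChangeOfVariables.
Context {R : realType} {n : nat}.
Local Notation V := 'rV[R]_n.+1.
Local Notation mu := (lebesgue_outer_measure R n).
Variables (Omega : set V) (M : R) (u : V -> \bar R).
Hypotheses (Oconv : convex_set Omega) (Oclosed : closed Omega).
Hypotheses (uCM : CM Omega M u) (O0 : Omega !=set0).

Let ucc : closed_convex u. Proof. by have [] := uCM. Qed.
Let udom : effdom u = Omega. Proof. by have [] := uCM. Qed.
Let u_ge0 : forall x, (0 <= u x)%E.
Proof. by have [_ _ + _] := uCM; exact: ereal_inf_ge0. Qed.
Let dom0 : effdom u !=set0. Proof. by rewrite udom. Qed.
Let uM x : effdom u x -> (u x <= M%:E)%E.
Proof. by rewrite udom; have [_ _ _] := uCM; apply. Qed.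

Let G : V -> V := gradient (fine \o u).

(** The regular points, where the multivalued map [subdiff u] is the gradient. *)
Let D : set V := [set x | Omega° x /\ exists p, subdiff u x = [set p]].

Let DG x : D x -> subdiff u x = [set G x].
Proof.
move=> [Ox [p xp]]; rewrite xp; congr [set _].
by apply/esym/(gradient_unique_subdiff ucc u_ge0 dom0 uM) => //; rewrite udom.
Qed.

Let subD : D `<=` Omega.
Proof. by move=> x [/interior_subset]. Qed.

Lemma singular_null : mu (Omega `\` D) = 0%E.
Proof.
apply/eqP; rewrite eq_le outer_measure_ge0 andbT.
have := outer_measureU2 mu (Omega `\` Omega°) [set x | exists p q,
  [/\ subdiff u x p, subdiff u x q & p <> q]].
rewrite convex_boundary_null// subdiff_multi_null adde0; apply: le_trans.
apply: le_outer_measure => x [Ox nDx].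
have [xi|xi] := pselect (Omega° x); [right|by left].
apply: contrapT => nex; apply: nDx; split=> //.
have [p xp] : subdiff u x !=set0.
  by apply: (subdiff_interior_nonempty ucc u_ge0 dom0 uM); rewrite udom.
exists p; apply/seteqP; split=> q; last by move=> ->.
by move=> xq; apply: contrapT => pq; apply: nex; exists q, p.
Qed.

Let mN : measurable (Omega `\` D : set (lebesgueType R n)).
Proof. exact/null_lebesgue_measurable/singular_null. Qed.

Let mO : measurable (Omega : set (lebesgueType R n)).
Proof.
rewrite -(setCK Omega); apply: measurableC.
by apply: open_lebesgue_measurable; exact: closed_openC.
Qed.

Let mD : measurable (D : set (lebesgueType R n)).
Proof.
rewrite (_ : D = Omega `\` (Omega `\` D)); first exact: measurableD.
by rewrite setDD setIidr.
Qed.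

(** The gradient restricted to [D]; the value [0] elsewhere makes it a total
    measurable map. *)
Let T (x : lebesgueType R n) : borelType R n := if x \in D then G x else 0.

Let mT : measurable_fun [set: lebesgueType R n] T.
Proof.
have gen : @measurable _ (borelType R n) =
  <<s (@open V : set (set (borelType R n))) >> by [].
apply: (measurability _ gen) => _ [U oU <-]; rewrite setTI.
(* [W] is open by [subdiff_usc], and on [D] it is the preimage of [U]. *)
pose W := [set x | Omega° x /\ subdiff u x `<=` U].
have oW : open W.
  rewrite openE => x [Ox xU].
  have := subdiff_usc ucc u_ge0 dom0 uM _ oU xU; rewrite udom => /(_ Ox).
  by apply: filterS2 (nbhs_interior Ox) => y.
have -> : T @^-1` U = (D `&` W) `|` (if 0 \in U then ~` D else set0).
  apply/seteqP; split=> x; rewrite /T /=.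
    case: ifPn => [/set_mem Dx GU|/negP nDx U0].
      by left; split=> //; split; [exact: Dx.1|rewrite DG// => _ ->].
    by right; rewrite mem_set// => Dx; apply: nDx; rewrite mem_set.
  move=> [[Dx [_ xU]]|].
    by rewrite mem_set//; apply: xU; rewrite DG.
  by case: ifPn => // /set_mem U0 nDx; rewrite memNset.
apply: measurableU.
  by apply: measurableI => //; exact: open_lebesgue_measurable.
by case: ifP => _ //; exact: measurableC.
Qed.

Let h (p : V) : \bar R := ((1 + dot p p)^-1)%:E.

Let h_ge0 p : (0 <= h p)%E.
Proof. by rewrite lee_fin invr_ge0 addr_ge0// dot_ge0. Qed.

Let mh : measurable_fun [set: borelType R n] h.
Proof.
apply/measurable_EFinP.
apply: (continuous_borel_measurable (g := fun p => (1 + dot p p)^-1)) => p.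
have cid : {for p, continuous (@id V)} by exact: cvg_id.
have := continuous_dot cid cid.
move=> cpp; apply: (@continuousV _ _ (fun p => 1 + dot p p)).
  by rewrite gt_eqF// ltr_pwDl// dot_ge0.
have c1 : {for p, continuous (fun _ : V => 1 : R)} by exact: cst_continuous.
exact: (continuousD c1 cpp).
Qed.

Let mhT : measurable_fun [set: lebesgueType R n] (h \o T).
Proof. exact: measurableT_comp. Qed.

(** Duality turns the union of the subdifferentials of the conjugate over [eta]
    into the set of points where [u] has a subgradient in [eta]; outside the
    null set of singular points, the gradient is the only candidate. *)
Let hessian0E (eta : set (borelType R n)) :
  hessian0 (legendre_conj u) eta =
  pushforward (mrestr (lebesgue_n R n) mD) T eta.
Proof.
rewrite /hessian0 /pushforward /mrestr; set A := \bigcup_(p in _) _.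
have AE x : A x <-> exists2 p, eta p & subdiff u x p.
  by split=> -[p ep]; move/(subdiff_conj ucc u_ge0 dom0); exists p.
apply/eqP; rewrite eq_le; apply/andP; split.
  apply: (@le_trans _ _ (mu ((T @^-1` eta `&` D) `|` (Omega `\` D)))).
    apply: le_outer_measure => x /AE[p ep xp].
    have [Dx|nDx] := pselect (D x); [left|right]; split=> //.
      by move: xp; rewrite DG// /T/= mem_set// => <-.
    by rewrite -udom /effdom /=; have [xfin _] := xp; rewrite ltey_eq xfin.
  by apply: le_trans (outer_measureU2 _ _ _) _; rewrite singular_null adde0.
apply: le_outer_measure => x [+ Dx]; rewrite /T /= mem_set// => eG.
by apply/AE; exists (G x) => //; rewrite DG.
Qed.

Lemma J_Jstar : J Omega u = Jstar (legendre_conj u).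
Proof.
rewrite /J /Jstar -/G -[LHS]/(\int[lebesgue_n R n]_(x in Omega) h (G x))%E.
rewrite -[RHS]/(\int[hessian0 (legendre_conj u)]_p h p)%E.
rewrite (eq_setfun_integral _ _ (fun eta _ => hessian0E eta)).
rewrite ge0_integral_pushforward// preimage_setT.
rewrite (ge0_integral_mrestr (lebesgue_n R n) mD mhT (fun x => h_ge0 (T x))).
have hTG : {in D, h \o T =1 h \o G}.
  by move=> x Dx; rewrite /= /T Dx.
have mhG : measurable_fun (Omega : set (lebesgueType R n)) (h \o G).
  have -> : Omega = D `|` (Omega `\` D) by rewrite setDUK.
  apply/measurable_funU => //; split.
    apply: (@eq_measurable_fun _ _ (lebesgueType R n) _ D (h \o T) (h \o G)).
      exact: hTG.
    exact: measurable_funTS.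
  move=> _ Y _; apply: null_lebesgue_measurable.
  apply/eqP; rewrite eq_le outer_measure_ge0 andbT -singular_null.
  by apply: le_outer_measure => x [].
have -> := @ge0_negligible_integral _ (lebesgueType R n) R (lebesgue_n R n)
  Omega (Omega `\` D) (h \o G) mN mO mhG (fun x _ => h_ge0 (G x)) singular_null.
rewrite setDD setIidr//; apply: eq_integral => x Dx.
by rewrite -[LHS]hTG.
Qed.

End ChangeOfVariables.

Theorem theorem1 (R : realType) (n : nat) (Omega : set 'rV[R]_n.+1) (M : R)
    (hconv : convex_set Omega) (hcomp : compact Omega)
    (hint : Omega° !=set0) (hM : 0 <= M)
    (u : 'rV[R]_n.+1 -> \bar R)
    (hu : closed_convex u) (hproper : proper_fun u) :
  (CM Omega M u <-> CMstar Omega M (legendre_conj u)) /\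
  (CM Omega M u -> J Omega u = Jstar (legendre_conj u)).
Proof.
have cO : closed Omega by apply: compact_closed hcomp; exact: norm_hausdorff.
have O0 : Omega !=set0 by have [x /interior_subset] := hint; exists x.
split; last by move=> uCM; exact: J_Jstar uCM O0.
split; first exact: CM_CMstar.
exact: CMstar_CM.
Qed.
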